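(* For all $m\ge 1$ and $n\ge 3$, the tadpole graph $T_{m,n}$ is $Q$-unique: if $H$ is a finite simple graph with $Q(H;x,y)=Q(T_{m,n};x,y)$, then $H\cong T_{m,n}$.
   Context: For a finite simple graph $G=(V,E)$, the subgraph component polynomial is $Q(G;x,y)=\sum_{X\subseteq V} x^{|X|}y^{k(G[X])}$, where $G[X]$ is the induced subgraph on $X$ and $k(\cdot)$ denotes the number of connected components. The $(m,n)$-tadpole graph $T_{m,n}$ is obtained from a path $P_m$ (on $m$ vertices) and a cycle $C_n$ (on $n$ vertices), vertex-disjoint, by adding one edge (a bridge) joining an end vertex of the path to a vertex of the cycle; it has $m+n$ vertices and $m+n$ edges. *)

(* Defs.v *)
From mathcomp Require Import all_boot all_order all_algebra.

Set Implicit Arguments.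
Unset Strict Implicit.
Unset Printing Implicit Defensive.

Import GRing.Theory.

Record sgraph := SGraph {
  vertex :> finType;
  adj : rel vertex;
  adj_sym : symmetric adj;
  adj_irr : irreflexive adj
}.
Arguments adj {s} : rename.

Section Induced.
Variables (G : sgraph) (X : {set G}).

Definition induced_adj : rel {v : G | v \in X} :=
  [rel u v | adj (val u) (val v)].

Fact induced_sym : symmetric induced_adj.
Proof. by move=> u v; apply: adj_sym. Qed.

Fact induced_irr : irreflexive induced_adj.
Proof. by move=> u; apply: adj_irr. Qed.

Definition induced : sgraph := SGraph induced_sym induced_irr.

End Induced.

Definition num_comp (G : sgraph) : nat := n_comp (@adj G) predT.

(* In {poly {poly int}} the variable x is the outer indeterminate 'X and y is
   the inner one, 'X%:P. *)
Definition Qpoly (G : sgraph) : {poly {poly int}} :=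
  (\sum_(X : {set G}) 'X ^+ #|X| * ('X%:P) ^+ num_comp (induced X))%R.

Definition isomorphic (G H : sgraph) : Prop :=
  exists2 f : G -> H, bijective f & forall u v, adj (f u) (f v) = adj u v.

Definition Q_unique (G : sgraph) : Prop :=
  forall H : sgraph, Qpoly H = Qpoly G -> isomorphic H G.

Section FromRel.
Variables (T : finType) (r : rel T).

Definition simple_adj : rel T := [rel u v | (u != v) && (r u v || r v u)].

Fact simple_sym : symmetric simple_adj.
Proof. by move=> u v; rewrite /simple_adj /= eq_sym orbC. Qed.

Fact simple_irr : irreflexive simple_adj.
Proof. by move=> u; rewrite /simple_adj /= eqxx. Qed.

Definition simple_graph : sgraph := SGraph simple_sym simple_irr.

End FromRel.

Definition path_graph (m : nat) : sgraph :=
  simple_graph [rel i j : 'I_m | i.+1 == j].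

(* This is the cycle C_n only for 3 <= n. *)
Definition cycle_graph (n : nat) : sgraph :=
  simple_graph [rel i j : 'I_n | i.+1 %% n == j].

(* The bridge joins the end vertex 0 of the path to the vertex 0 of the cycle. *)
Definition tadpole_rel (m n : nat) : rel (path_graph m + cycle_graph n) :=
  fun u v => match u, v with
  | inl i, inl j => adj i j
  | inr i, inr j => adj i j
  | inl i, inr j => (val i == 0) && (val j == 0)
  | inr _, inl _ => false
  end.

Definition tadpole (m n : nat) : sgraph := simple_graph (@tadpole_rel m n).

(* Main.v *)
Require Import Defs.
From mathcomp Require Import all_boot all_order all_algebra.
From mathcomp Require Import zify.

(* Q determines, for all k and j, the number of k-sets inducing j components.
   The case k = 2 gives the number of edges, hence the sum of the degrees d(v).
   Summing, over all 3-sets, the number of edges inside the set recovers the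
   number of triangles from the components of 3-sets, hence the sum of
   'C(d(v), 2). For a graph with the Q of a tadpole these two sums force one vertex of
   degree 1, one of degree 3, and degree 2 elsewhere. Being connected, such a
   graph is swept by a maximal path that starts at the leaf; the last vertex of
   the path can only be joined back to the vertex of degree 3, so the graph is
   a tadpole. The length of its tail is the number of vertices whose deletion
   disconnects it, which Q also determines. *)

Set Implicit Arguments.
Unset Strict Implicit.
Unset Printing Implicit Defensive.

(** * Components of induced subgraphs, in particular of pairs and triples *)

Section Components.
Variable G : sgraph.
Implicit Types (X : {set G}) (u v : G).

(* Components of G[X] are counted inside G itself, so that different X can be
   compared without changing the vertex type. *)
Definition restrict X : rel G :=
  [rel u v | [&& u \in X, v \in X & adj u v]].

Definition comps X : nat := n_comp (restrict X) (mem X).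

Lemma restrict_connect_sym X : connect_sym (restrict X).
Proof.
apply: sym_connect_sym => u v.
by rewrite /restrict /= andbCA adj_sym.
Qed.

Lemma restrict_closed X : closed (restrict X) (mem X).
Proof. by move=> u v /and3P[uX vX _]; rewrite uX vX. Qed.

(** The inclusion of G[X] into G preserves and reflects adjacency, and its image X is closed under
    [restrict X]. It is therefore a strict adjunction, which matches components with components. *)
Lemma num_comp_induced X : num_comp (induced X) = comps X.
Proof.
rewrite /comps (@adjunction_n_comp _ _ (val : induced X -> G)
  _ (@adj (induced X))).
- by apply: eq_n_comp_r => u; rewrite !inE (valP u).
- exact: restrict_connect_sym.
- exact/sym_connect_sym/induced_sym.
- exact: restrict_closed.
- apply: strict_adjunction => //.
  + exact/sym_connect_sym/induced_sym.
  + exact: restrict_closed.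
  + exact: val_inj.
  + by apply/subsetP=> u uX; apply/codomP; exists (Sub u uX); rewrite SubK.
  + by move=> [u uX] [v vX] _ /=; rewrite /induced_adj /restrict /= uX vX.
Qed.

(** The root of the only component serves as the witness u. Asking for a u in X also excludes the
    empty set, which has 0 components. *)
Lemma comps1P X :
  reflect (exists2 u, u \in X & forall v, v \in X -> connect (restrict X) u v)
          (comps X == 1).
Proof.
have symX := restrict_connect_sym X.
apply: (iffP eqP) => [/mem_card1[u compX] | [u uX connX]].
  have [rootu uX] : u \in roots (restrict X) /\ u \in X.
    by have:= compX u; rewrite !inE eqxx => /andP[].
  exists u => // v vX.
  have rvX : fingraph.root (restrict X) v \in X.
    by rewrite -(closed_connect (@restrict_closed X) (connect_root _ v)).
  have:= compX (fingraph.root (restrict X) v).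
  rewrite !inE (roots_root symX) rvX /= => /esym/eqP <-.
  by rewrite symX connect_root.
rewrite -(n_comp_connect symX u); apply: eq_n_comp_r => v.
apply/idP/idP; first exact: connX.
by move/(closed_connect (@restrict_closed X)) => <-.
Qed.

Lemma comps0 : comps set0 = 0.
Proof. by apply: eq_card0 => u; rewrite !inE andbF. Qed.

(** Removing an isolated u does not change the relation [restrict X], so the roots stay the same,
    except that u, its own root, no longer counts. *)
Lemma comps_isolated X u :
  u \in X -> (forall v, v \in X -> ~~ adj u v) -> comps X = (comps (X :\ u)).+1.
Proof.
move=> uX isou.
have eqr : restrict X =2 restrict (X :\ u).
  move=> v w; rewrite /restrict /= !inE.
  have [->|_] := eqVneq v u => /=.
    by rewrite uX /=; case: (boolP (w \in X)) => //= /isou /negbTE.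
  have [->|//] := eqVneq w u.
  case: (boolP (v \in X)) => //= /isou; rewrite adj_sym => /negbTE ->.
  by rewrite andbF.
have rootu : u \in roots (restrict X).
  rewrite inE /roots; have:= connect_root (restrict X) u.
  case/connectP=> [[|v p]] /=; first by move=> _ ->.
  by case/andP=> /and3P[_ vX]; rewrite (negbTE (isou v vX)).
rewrite /comps -(eq_n_comp (eq_connect eqr)) /n_comp_mem.
rewrite (cardD1 u); have -> : u \in predI (roots (restrict X)) (mem (mem X)).
  by apply/andP; split.
rewrite add1n; congr _.+1.
by apply: eq_card => v; rewrite !inE andbCA.
Qed.

Lemma comps_pair u v : u != v -> comps [set u; v] = if adj u v then 1 else 2.
Proof.
move=> uv; case: ifP => [auv|nauv].
  apply/eqP/comps1P; exists u; first exact: set21.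
  move=> w /set2P[]->; first exact: connect0.
  by apply: connect1; rewrite /restrict /= set21 set22.
have comp1 w : comps [set w] = 1.
  rewrite (@comps_isolated _ w) ?set11 // => [|x /set1P->].
    by rewrite setDv comps0.
  by rewrite adj_irr.
rewrite (@comps_isolated _ u) ?set21 // => [|w /set2P[]->];
  rewrite ?adj_irr ?nauv //.
by rewrite setU1K ?inE // comp1.
Qed.

Lemma comps_triple_connected u v w :
  adj u v -> adj u w -> comps [set u; v; w] = 1.
Proof.
move=> uv uw; apply/eqP/comps1P; exists u; first by rewrite !inE eqxx.
move=> x; rewrite !inE -orbA => /or3P[]/eqP->; first exact: connect0.
  by apply: connect1; rewrite /restrict /= !inE !eqxx uv !orbT.
by apply: connect1; rewrite /restrict /= !inE !eqxx uw !orbT.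
Qed.

Lemma comps_triple_isolated u v w : u != v -> u != w -> v != w ->
  ~~ adj u v -> ~~ adj u w -> comps [set u; v; w] = if adj v w then 2 else 3.
Proof.
move=> uv uw vw nuv nuw.
rewrite -setUA (@comps_isolated _ u) ?setU11 //.
  rewrite setU1K ?comps_pair //; first by case: ifP.
  by rewrite !inE negb_or uv.
by move=> x; rewrite !inE => /or3P[]/eqP-> //; rewrite adj_irr.
Qed.

End Components.

Lemma comps_imset (G H : sgraph) (f : G -> H) (X : {set G}) :
  injective f -> (forall u v, adj (f u) (f v) = adj u v) ->
  comps (f @: X) = comps X.
Proof.
move=> injf adjf.
rewrite /comps (@adjunction_n_comp _ _ f _ (restrict X)).
- by apply: eq_n_comp_r => u; rewrite !inE mem_imset.
- exact: restrict_connect_sym.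
- exact: restrict_connect_sym.
- exact: restrict_closed.
- apply: strict_adjunction => //.
  + exact: restrict_connect_sym.
  + exact: restrict_closed.
  + by apply/subsetP=> v /imsetP[u _ ->]; apply: codom_f.
  + by move=> u v _ /=; rewrite /restrict /= !mem_imset // adjf.
Qed.

(** * Invariants read off from Q *)

Definition subset_count (G : sgraph) (k j : nat) : nat :=
  #|[set X : {set G} | (#|X| == k) && (comps X == j)]|.

Section Polynomial.
Import GRing.Theory.
Local Open Scope ring_scope.

Lemma Qpoly_comps (G : sgraph) :
  Qpoly G = \sum_(X : {set G}) 'X ^+ #|X| * 'X%:P ^+ comps X.
Proof. by apply: eq_bigr => X _; rewrite num_comp_induced. Qed.

Lemma Qpoly_isomorphic (G H : sgraph) : isomorphic G H -> Qpoly G = Qpoly H.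
Proof.
case=> f bijf adjf; have injf := bij_inj bijf.
rewrite !Qpoly_comps [RHS](reindex (fun X : {set G} => f @: X)).
  by apply: eq_bigr => X _; rewrite card_imset // comps_imset.
apply: onW_bij; case: bijf => g fK gK.
exists (fun Y : {set H} => g @: Y) => X; rewrite -imset_comp.
  by rewrite (eq_imset _ (g := id)) ?imset_id.
by rewrite (eq_imset _ (g := id)) ?imset_id.
Qed.

Lemma coef_Qpoly (G : sgraph) k j :
  (Qpoly G)`_k`_j = (subset_count G k j)%:R.
Proof.
rewrite Qpoly_comps !coef_sum /subset_count -sum1_card natr_sum.
rewrite [RHS]big_mkcond /=.
apply: eq_bigr => X _.
rewrite -polyC_exp coefMC coefXn inE ![_ == #|X|]eq_sym.
case: (#|X| == k); rewrite ?mul1r ?mul0r ?coef0 //= coefXn eq_sym.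
by case: (comps X == j).
Qed.

(** At x = y = 1 every subset contributes 1. This makes the number of vertices readable from Q. *)
Lemma horner_Qpoly (G : sgraph) : (Qpoly G).[1].[1] = (2 ^ #|G|)%:R.
Proof.
rewrite Qpoly_comps !horner_sum.
rewrite (eq_bigr (fun=> 1)) => [|X _]; last first.
  by rewrite -polyC_exp !(hornerE, hornerXn, expr1n).
by rewrite sumr_const -2!cardsT -card_powerset powersetT.
Qed.

End Polynomial.

Section SameQ.
Variables G H : sgraph.
Hypothesis eqQ : Qpoly G = Qpoly H.

Lemma eq_card_Qpoly : #|G| = #|H|.
Proof.
have:= horner_Qpoly G; rewrite eqQ horner_Qpoly => /eqP.
by rewrite Num.Theory.eqr_nat eqn_exp2l // => /eqP.
Qed.

Lemma eq_subset_count_Qpoly : subset_count G =2 subset_count H.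
Proof.
move=> k j; have:= coef_Qpoly G k j; rewrite eqQ coef_Qpoly => /eqP.
by rewrite Num.Theory.eqr_nat => /eqP.
Qed.

End SameQ.

(** * Degree sums from the counts of 2-sets and 3-sets *)

Lemma card_between (T : finType) (S A : {set T}) k : [disjoint S & A] ->
  #|[set X : {set T} | [&& #|X| == #|S| + k, S \subset X & X \subset S :|: A]]|
  = 'C(#|A|, k).
Proof.
move=> disSA; rewrite -cards_draws.
have disS (Y : {set T}) : Y \subset A -> [disjoint S & Y].
  by move=> YA; apply: disjointWr disSA.
(* The sets counted are the unions of S with a k-subset Y of A, and Y is recovered by removing S. *)
rewrite -[RHS](card_in_imset (f := fun Y => S :|: Y)).
  apply: eq_card => X; rewrite inE; apply/and3P/imsetP.
    case=> /eqP cardX SX XSA; exists (X :\: S).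
      rewrite inE cardsD (setIidPr SX) cardX addKn eqxx andbT.
      by rewrite subDset.
    by rewrite -{1}(setID X S) (setIidPr SX).
  case=> Y; rewrite inE => /andP[YA /eqP cardY] ->.
  rewrite subsetUl setUS //; split=> //.
  by rewrite cardsU (disjoint_setI0 (disS _ YA)) cards0 subn0 cardY.
have cancelS (Y : {set T}) : Y \subset A -> (S :|: Y) :\: S = Y.
  move=> /disS; rewrite disjoint_sym => /setDidPl; rewrite setDUl setDv set0U.
  by [].
move=> Y Z; rewrite !inE => /andP[YA _] /andP[ZA _] eqYZ.
by rewrite -(cancelS Y YA) eqYZ cancelS.
Qed.

Section Degrees.
Variable G : sgraph.
Implicit Types (X : {set G}) (u v : G).

Definition nbh v : {set G} := [set u | adj v u].
Definition deg v : nat := #|nbh v|.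

(* [arcs] counts every edge of G[X] twice. *)
Definition arcs X : nat := \sum_(u in X) \sum_(v in X) adj u v.
(** For a 3-set X these are the two-edge paths inside X, counted by their middle vertex v. *)
Definition cherries X : nat := \sum_(v in X) (X :\ v \subset nbh v).

(** Double counting: a fixed arc (u, v) lies in one (k + 2)-set for each k-subset of the complement
    of {u, v}, and the number of arcs is the sum of the degrees. *)
Lemma sum_arcs k :
  \sum_(X : {set G} | #|X| == k.+2) arcs X = (\sum_v deg v) * 'C(#|G| - 2, k).
Proof.
transitivity (\sum_(X : {set G} | #|X| == k.+2) \sum_u \sum_v
    [&& u \in X, v \in X & adj u v]).
  apply: eq_bigr => X _; rewrite /arcs big_mkcond; apply: eq_bigr => u _ /=.
  case: (u \in X) => /=; last by rewrite big1.
  by rewrite big_mkcond; apply: eq_bigr => v _ /=; case: (v \in X).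
rewrite exchange_big big_distrl /=; apply: eq_bigr => u _.
rewrite exchange_big /deg -sum1_card big_distrl [RHS]big_mkcond /=.
apply: eq_bigr => v _; rewrite inE.
case: (boolP (adj u v)) => [uv|_]; last first.
  by rewrite big1 // => X _; rewrite !andbF.
have neq_uv : u != v by apply: contraTneq uv => ->; rewrite adj_irr.
have card2 : #|[set u; v]| = 2 by rewrite cards2 neq_uv.
have cardC : #|~: [set u; v]| = #|G| - 2 by rewrite cardsCs setCK card2.
rewrite mul1n -cardC -(@card_between _ [set u; v]); last first.
  by rewrite -setI_eq0 setICr.
rewrite -sum1dep_card card2 [RHS]big_mkcond [LHS]big_mkcond /=.
apply: eq_bigr => X _; rewrite setUCr subsetT subUset !sub1set !andbT.
by case: (#|X| == k.+2) => //; case: (_ && _).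
Qed.

(** For fixed v, the 3-sets counted consist of v and two of its neighbours. *)
Lemma sum_cherries :
  \sum_(X : {set G} | #|X| == 3) cherries X = \sum_v 'C(deg v, 2).
Proof.
transitivity (\sum_(X : {set G} | #|X| == 3) \sum_v
    ((v \in X) && (X :\ v \subset nbh v))).
  apply: eq_bigr => X _; rewrite /cherries big_mkcond.
  by apply: eq_bigr => v _ /=; case: (v \in X).
rewrite exchange_big /=; apply: eq_bigr => v _.
rewrite -(@card_between _ [set v]) ?disjoints1 ?inE ?adj_irr // -sum1dep_card.
rewrite cards1 [RHS]big_mkcond [LHS]big_mkcond /=; apply: eq_bigr => X _.
rewrite sub1set -subDset.
by case: (#|X| == 3) => //; case: (v \in X) => //=; case: (_ \subset _).
Qed.

Lemma arcs_pair u v : u != v -> arcs [set u; v] = (adj u v).*2.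
Proof.
move=> uv; rewrite /arcs.
do ?rewrite big_setU1 ?inE //= ?big_set1.
by rewrite !adj_irr add0n addn0 (adj_sym v) addnn.
Qed.

Lemma comps_arcs_pair X : #|X| = 2 -> arcs X = (comps X == 1).*2.
Proof.
move/eqP/cards2P=> [u [v [uv ->]]].
by rewrite arcs_pair // comps_pair //; case: ifP.
Qed.

(* With e edges inside X, the four values of e give (cherries, comps, arcs) =
   (0, 3, 0), (0, 2, 2), (1, 1, 4) and (3, 1, 6). *)
Lemma comps_cherries_triple X : #|X| = 3 ->
  cherries X + 3 * (comps X == 1) + 2 * (comps X == 2) = arcs X.
Proof.
move=> cardX.
have [u uX] : exists u, u \in X by apply/card_gt0P; rewrite cardX.
have /eqP/cards2P[v [w [vw XE]]] : #|X :\ u| = 2.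
  by have:= cardsD1 u X; rewrite uX cardX add1n => -[].
have [uv uw] : u != v /\ u != w.
  have: u \notin X :\ u by rewrite !inE eqxx.
  by rewrite XE !inE negb_or => /andP.
have {uX XE}-> : X = [set u; v; w] by rewrite -setUA -XE setD1K.
have arcsE : arcs [set u; v; w] = (adj u v + adj u w + adj v w).*2.
  rewrite /arcs -setUA.
  do ?rewrite big_setU1 ?inE ?negb_or ?uv ?uw //= ?big_set1.
  rewrite !adj_irr (adj_sym v u) (adj_sym w u) (adj_sym w v); lia.
have cherriesE : cherries [set u; v; w] =
    (adj u v && adj u w) + (adj u v && adj v w) + (adj u w && adj v w).
  rewrite /cherries -setUA.
  do ?rewrite big_setU1 ?inE ?negb_or ?uv ?uw //= ?big_set1.
  have Du : (u |: [set v; w]) :\ u = [set v; w].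
    by rewrite setU1K // !inE negb_or uv.
  have Dv : (u |: [set v; w]) :\ v = [set u; w].
    by rewrite setUCA setU1K // !inE negb_or eq_sym uv.
  have Dw : (u |: [set v; w]) :\ w = [set u; v].
    by rewrite setUA setUC setU1K // !inE negb_or ![w == _]eq_sym uw.
  rewrite Du Dv Dw !subUset !sub1set !inE.
  by rewrite (adj_sym v u) (adj_sym w u) (adj_sym w v) addnA.
rewrite arcsE cherriesE.
(* The lemmas on triples expect first the vertex adjacent to both others, or to neither; these two
   rewritings bring it there. *)
have swap_uv : [set u; v; w] = [set v; u; w] by rewrite (setUC [set u]).
have rot_w : [set u; v; w] = [set w; u; v] by rewrite setUC setUA.
case auv: (adj u v); case auw: (adj u w); case avw: (adj v w) => /=.
- by rewrite comps_triple_connected.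
- by rewrite comps_triple_connected.
- by rewrite swap_uv comps_triple_connected // adj_sym.
- by rewrite rot_w comps_triple_isolated // 1?eq_sym // ?auv //
    adj_sym ?auw ?avw.
- by rewrite rot_w comps_triple_connected // adj_sym.
- by rewrite swap_uv comps_triple_isolated // 1?eq_sym // ?auw // ?avw //
    adj_sym ?auv.
- by rewrite comps_triple_isolated // ?auw ?auv ?avw.
- by rewrite comps_triple_isolated // ?auw ?auv ?avw.
Qed.

Lemma subset_countE k j :
  subset_count G k j = \sum_(X : {set G} | #|X| == k) (comps X == j).
Proof. by rewrite /subset_count -sum1dep_card big_mkcondr. Qed.

Lemma sum_deg : \sum_v deg v = 2 * subset_count G 2 1.
Proof.
have:= sum_arcs 0; rewrite bin0 muln1 => <-.
rewrite subset_countE big_distrr /=.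
by apply: eq_bigr => X /eqP cardX; rewrite comps_arcs_pair // mul2n.
Qed.

(** The identity for a single triple is summed over all 3-sets. Every other term being determined by
    Q, so is the sum of ['C(deg v, 2)]. *)
Lemma sum_deg_bin2 :
  \sum_v 'C(deg v, 2) + 3 * subset_count G 3 1 + 2 * subset_count G 3 2 =
  (\sum_v deg v) * (#|G| - 2).
Proof.
have:= sum_arcs 1; rewrite bin1 => <-; rewrite -sum_cherries !subset_countE.
rewrite !big_distrr -!big_split /=; apply: eq_bigr => X /eqP cardX.
by rewrite comps_cherries_triple.
Qed.

End Degrees.

Section SameQDegrees.
Variables G H : sgraph.
Hypothesis eqQ : Qpoly G = Qpoly H.

Lemma eq_sum_deg : \sum_(v : G) deg v = \sum_(v : H) deg v.
Proof. by rewrite !sum_deg (eq_subset_count_Qpoly eqQ). Qed.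

Lemma eq_sum_deg_bin2 : \sum_(v : G) 'C(deg v, 2) = \sum_(v : H) 'C(deg v, 2).
Proof.
have:= sum_deg_bin2 G; have:= sum_deg_bin2 H.
rewrite eq_sum_deg (eq_card_Qpoly eqQ) !(eq_subset_count_Qpoly eqQ).
by move=> <- /addIn/addIn.
Qed.

End SameQDegrees.

(** * The tadpole as a row of vertices: degrees and cut vertices *)

(* The tadpole with its m + n vertices in a row: 0 is the leaf, a = m is the
   vertex of degree 3, and the only edge off the row closes the cycle
   a, ..., N - 1. *)
Definition line_tadpole_rel (N a : nat) : rel 'I_N :=
  [rel i j : 'I_N | (i.+1 == j) || ((i == a :> nat) && (j.+1 == N))].

Definition line_tadpole (N a : nat) : sgraph :=
  simple_graph (@line_tadpole_rel N a).

Lemma isomorphic_sym G H : isomorphic G H -> isomorphic H G.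
Proof.
case=> f [g fK gK] adjf; exists g; first by exists f.
by move=> u v; rewrite -adjf !gK.
Qed.

Lemma isomorphic_trans G H K :
  isomorphic G H -> isomorphic H K -> isomorphic G K.
Proof.
case=> f bijf adjf [g bijg adjg]; exists (g \o f); first exact: bij_comp.
by move=> u v /=; rewrite adjg.
Qed.

(** Turns the remainder into an explicit wrap-around case, which linear arithmetic can handle. *)
Lemma modnS_eq n (i j : 'I_n) :
  (i.+1 %% n == j) = (i.+1 == j) || ((i.+1 == n) && (j == 0 :> nat)).
Proof.
have [iSn|] := ltnP i.+1 n; first by rewrite modn_small //; lia.
move=> ni; have -> : i.+1 = n by have:= ltn_ord i; lia.
by rewrite modnn; have:= ltn_ord j; lia.
Qed.

Lemma tadpole_line m n : 2 < n ->
  isomorphic (tadpole m n) (line_tadpole (m + n) m).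
Proof.
move=> n_gt2.
(* The path is reversed: its end 0, which carries the bridge, must land at m - 1, next to the cycle
   vertex 0 at position m. *)
pose f (u : tadpole m n) : line_tadpole (m + n) m := match u with
  | inl i => lshift n (rev_ord i) | inr j => rshift m j end.
pose g (k : line_tadpole (m + n) m) : tadpole m n := match split k with
  | inl i => inl (rev_ord i) | inr j => inr j end.
exists f.
  exists g => [[i|j]|k]; rewrite /f /g.
  - by rewrite (unsplitK (inl _)) rev_ordK.
  - by rewrite (unsplitK (inr _)).
  - case: splitP => [i|j] ki; apply: val_inj; rewrite /= ki //.
    by have:= ltn_ord i; lia.
have inlE (i j : 'I_m) : (inl i == inl j :> 'I_m + 'I_n) = (i == j) by [].
have inrE (i j : 'I_n) : (inr i == inr j :> 'I_m + 'I_n) = (i == j) by [].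
move=> [i|i] [j|j]; rewrite /= /simple_adj /= ?inlE ?inrE /simple_adj /=;
  rewrite /line_tadpole_rel /= -!val_eqE /= ?modnS_eq;
  have:= ltn_ord i; have:= ltn_ord j.
- by move: (nat_of_ord i) (nat_of_ord j) => {}i {}j /=; lia.
- by move: (nat_of_ord i) (nat_of_ord j) => {}i {}j /=; lia.
- by move: (nat_of_ord i) (nat_of_ord j) => {}i {}j /=; lia.
- by move: (nat_of_ord i) (nat_of_ord j) => {}i {}j /=; lia.
Qed.

Lemma sum_ord_eq n k : \sum_(j < n) (j == k :> nat) = (k < n).
Proof.
case: (ltnP k n) => [kn | nk].
  rewrite (bigD1 (Ordinal kn)) //= eqxx big1 // => j.
  by rewrite -val_eqE /= => /negbTE ->.
by rewrite big1 // => j _; have:= ltn_ord j; case: eqP => //; lia.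
Qed.

Section LineTadpole.
Variables (N a : nat).
Hypotheses (a_gt0 : 0 < a) (aN : a + 2 < N).
Local Notation T := (line_tadpole N a).

Lemma adj_line (i j : T) : adj i j =
  [|| i.+1 == j, j.+1 == i, (i == a :> nat) && (j.+1 == N) |
      (j == a :> nat) && (i.+1 == N)].
Proof. rewrite /= /simple_adj /line_tadpole_rel /= -val_eqE /=. lia. Qed.

Lemma deg_line (i : T) :
  deg i = if i == 0 :> nat then 1 else if i == a :> nat then 3 else 2.
Proof.
have iN := ltn_ord i.
rewrite /deg -sum1_card big_mkcond /=.
(* One indicator for each possible neighbour of i: next, previous, N - 1 when i = a, and a when i =
   N - 1. They never overlap because a + 2 < N. The factor [0 < i] is there because [0.-1] is 0. *)
transitivity (\sum_(j < N) ((j == i.+1 :> nat) + (0 < i) * (j == i.-1 :> nat) +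
   (i == a :> nat) * (j == N.-1 :> nat) + (i.+1 == N) * (j == a :> nat))).
  apply: eq_bigr => j _; have jN := ltn_ord j.
  rewrite inE adj_line !mulnb -[if _ then _ else _]/(nat_of_bool _).
  move: (nat_of_ord i) (nat_of_ord j) iN jN => {}i {}j iN jN. lia.
rewrite !big_split /= -!big_distrr /= !sum_ord_eq !mulnb.
move: (nat_of_ord i) iN => {}i iN.
by case: (i =P 0) => i0; [|case: (i =P a) => ia]; lia.
Qed.

(** A general F lets one computation serve both the sum of the degrees and the sum of their
    binomials. *)
Lemma sum_line (F : nat -> nat) :
  \sum_(i : T) F (deg i) = F 1 + F 3 + (N - 2) * F 2.
Proof.
have N_gt0 : 0 < N by lia.
have a_ltN : a < N by lia.
rewrite (bigD1 (Ordinal N_gt0)) // (bigD1 (Ordinal a_ltN)) /=; last first.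
  by rewrite -val_eqE /=; lia.
rewrite !deg_line /= eqxx gtn_eqF // -addnA; congr (_ + (_ + _)).
rewrite (eq_bigr (fun=> F 2)) => [|i]; last first.
  by rewrite deg_line -!val_eqE /= => /andP[/negbTE-> /negbTE->].
rewrite sum_nat_const; congr (_ * _).
have -> : N - 2 = #|~: [set (Ordinal N_gt0 : T); Ordinal a_ltN]|.
  by rewrite cardsCs setCK card_ord cards2 -val_eqE /= ltn_eqF.
by apply: eq_card => i; rewrite !inE negb_or.
Qed.

Lemma restrict_line_up (X : {set T}) (i j : T) : i <= j ->
  (forall k : T, i <= k <= j -> k \in X) -> connect (restrict X) i j.
Proof.
move=> ij inX; have [k] := ubnP (j - i).
elim: k i ij inX => // k IH i ij inX jik.
have [eqij|neqij] := eqVneq i j; first by rewrite eqij connect0.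
have lt_ij : i < j by rewrite ltn_neqAle ij andbT.
have iSN : i.+1 < N by apply: leq_ltn_trans (ltn_ord j).
apply: (@connect_trans _ _ (Ordinal iSN : T)).
  apply: connect1; apply/and3P; split; last by rewrite adj_line /= eqxx.
    by apply: inX; lia.
  by apply: inX => /=; lia.
apply: IH => /=; [done | | lia].
by move=> l il; apply: inX; lia.
Qed.

Lemma comps_line_setT : comps [set: T] = 1.
Proof.
have N_gt0 : 0 < N by lia.
apply/eqP/comps1P; exists (Ordinal N_gt0 : T) => // i _.
by apply: restrict_line_up.
Qed.

(** The vertices 1, ..., a separate the leaf 0 from N - 1. Deleting 0 leaves a row, and a gap beyond
    a is bypassed through the edge from a to N - 1. *)
Lemma comps_line_delete (v : T) :
  (comps (~: [set v]) == 1) = ~~ (0 < v <= a).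
Proof.
have vN := ltn_ord v; set X := ~: [set v].
have memX (i : T) : (i \in X) = (i != v :> nat) by rewrite !inE -val_eqE.
have symX := restrict_connect_sym X.
have lastN : N.-1 < N by lia.
have aN' : a < N by lia.
have N_gt0 : 0 < N by lia.
apply/comps1P/idP => [[u uX connX]|].
  apply/negP=> v_cut.
  (* No edge of the rest leaves the positions below v: the edge from a to N - 1 has neither end
     below v. *)
  have closX : closed (restrict X) [pred i : T | i < v].
    apply: (intro_closed symX) => i j /and3P[]; rewrite !memX adj_line.
    have := ltn_ord i; have := ltn_ord j; rewrite !inE.
    by move: (nat_of_ord i) (nat_of_ord j) (nat_of_ord v) v_cut => x y z; lia.
  have lastX : connect (restrict X) u (Ordinal lastN : T).
    by apply: connX; rewrite memX /=; lia.
  have firstX : connect (restrict X) u (Ordinal N_gt0 : T).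
    by apply: connX; rewrite memX /=; lia.
  have:= closed_connect closX lastX.
  by rewrite (closed_connect closX firstX) !inE /=; lia.
rewrite negb_and -leqNgt -ltnNge => v_end.
case: (posnP v) => [v0|v_gt0].
  exists (Ordinal lastN : T) => [|i]; rewrite memX /=; first lia.
  move=> iv; rewrite symX; apply: restrict_line_up => /=.
    by have:= ltn_ord i; lia.
  by move=> k; rewrite memX; lia.
have av : a < v by lia.
(* With v beyond a, the positions below v form a row through a, and those above v a row ending at N
   - 1, which is adjacent to a. *)
exists (Ordinal aN' : T) => [|i]; rewrite memX /=; first lia.
move=> iv; have iN := ltn_ord i; case: (ltnP i v) => [ltiv|leiv].
  case: (leqP i a) => ia; last first.
    by apply: restrict_line_up => /= [|k]; rewrite ?memX; lia.
  rewrite symX.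
  by apply: restrict_line_up => /= [|k]; rewrite ?memX; lia.
apply: (@connect_trans _ _ (Ordinal lastN : T)).
  apply: connect1; apply/and3P; rewrite !memX adj_line /= eqxx.
  by split; lia.
rewrite symX.
by apply: restrict_line_up => /= [|k]; rewrite ?memX; [|have:= ltn_ord k]; lia.
Qed.

(** The (N - 1)-sets are the complements of single vertices, of which exactly a are cut vertices.
    The tail length is later read from this coefficient. *)
Lemma subset_count_line : subset_count T N.-1 1 = N - a.
Proof.
have cardT : #|T| = N by apply: card_ord.
transitivity #|[set v : T | ~~ (0 < v <= a)]|.
  rewrite -(card_in_imset (f := fun v : T => ~: [set v])); last first.
    by move=> u v _ _ /setC_inj/set1_inj.
  apply: eq_card => X; rewrite inE; apply/andP/imsetP.
    case=> cardX compX.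
    have /eqP/cards1P[v Xv] : #|~: X| = 1.
      by rewrite cardsCs setCK (eqP cardX) cardT; lia.
    have XE : X = ~: [set v] by rewrite -Xv setCK.
    by exists v => //; rewrite inE -comps_line_delete -XE.
  case=> v; rewrite inE -comps_line_delete => compX ->; split=> //.
  by rewrite cardsCs setCK cards1 cardT subn1.
have -> : [set v : T | ~~ (0 < v <= a)] = ~: [set v : T | 0 < v <= a].
  by apply/setP => v; rewrite !inE.
rewrite cardsCs setCK cardT; congr (_ - _).
rewrite -sum1dep_card big_mkcond /=.
(* The minimum keeps the formula valid for all N, so that the induction can pass through values not
   exceeding a. *)
transitivity (minn N.-1 a); last by lia.
elim: (N) => [|n IH]; first by rewrite big_ord0 min0n.
by rewrite big_ord_recr /= IH; case: ifP => /=; lia.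
Qed.

End LineTadpole.

(** * Recognition of a tadpole from connectedness and degree sums *)

(* f = (d - 2)(d - 3) / 2, written without truncated subtraction. *)
Lemma bin2_tangent d : exists2 f,
  'C(d, 2) + 3 = 2 * d + f &
  (f = 0 -> d = 2 \/ d = 3) /\ (f = 1 -> d = 1 \/ d = 4).
Proof.
case: d => [|[|[|[|[|d]]]]];
  [exists 3|exists 1|exists 0|exists 0|exists 1|];
  try by split; auto.
exists ('C(d, 2) + 3 * d + 3); last by split; lia.
rewrite !binS !bin1 !bin0; lia.
Qed.

Section Recognition.
Variable G : sgraph.
Implicit Types (u v l w : G).

(** With f(d) = (d - 2)(d - 3)/2, the hypotheses give the sum of f as |G| + 1 + 3|G| - 4|G| = 1. So
    a single vertex l has f = 1, hence degree 1 or 4, and all others have degree 2 or 3. *)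
Lemma degree_sequence :
  \sum_(v : G) deg v = 2 * #|G| -> \sum_(v : G) 'C(deg v, 2) = #|G| + 1 ->
  exists l w, [/\ deg l = 1, deg w = 3 &
    forall v, v != l -> v != w -> deg v = 2].
Proof.
move=> sum1 sum2.
pose f v := 'C(deg v, 2) + 3 - 2 * deg v.
have fE v : 'C(deg v, 2) + 3 = 2 * deg v + f v.
  by rewrite /f; have [k ->] := bin2_tangent (deg v); rewrite addKn.
have f0 v : f v = 0 -> deg v = 2 \/ deg v = 3.
  have [k kE [k0 _]] := bin2_tangent (deg v); have := fE v; rewrite kE.
  by move/addnI => <-.
have f1 v : f v = 1 -> deg v = 1 \/ deg v = 4.
  have [k kE [_ k1]] := bin2_tangent (deg v); have := fE v; rewrite kE.
  by move/addnI => <-.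
have sumf : \sum_v f v = 1.
  have: \sum_(v : G) ('C(deg v, 2) + 3) = \sum_(v : G) (deg v + deg v + f v).
    by apply: eq_bigr => v _; rewrite fE mul2n addnn.
  have sum3 : \sum_(v : G) 3 = #|G| * 3 by rewrite sum_nat_const.
  by rewrite !big_split /= sum1 sum2 sum3; lia.
move/eqP: sumf => /sum_nat_eq1[l [_ fl fother]].
have deg_other v : v != l -> deg v = 2 + (deg v - 2).
  by move=> vl; have [||] := f0 v; [apply: fother | lia | lia].
move: sum1; rewrite (bigD1 l) //= (eq_bigr _ deg_other) big_split /=.
have -> : \sum_(v | v != l) 2 = #|G|.-1 * 2 by rewrite sum_nat_const cardC1.
set s := \sum_(_ | _) _ => sum1.
have G_gt0 : 0 < #|G| by apply/card_gt0P; exists l.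
(* Degree 4 at l would make the degree sum at least 2|G| + 2. So l has degree 1, and the total
   excess s over degree 2 elsewhere is 1, which singles out w. *)
have [deg_l|deg_l] := f1 l fl; last first.
  by exfalso; move: G_gt0 sum1; rewrite deg_l; move: #|G| (s); lia.
have: s == 1 by move: G_gt0 sum1; rewrite deg_l; move: #|G| (s); lia.
move/sum_nat_eq1=> [w [wl deg_w wother]].
exists l, w; split=> //; first by lia.
by move=> v vl vw; rewrite deg_other // wother.
Qed.

Lemma maximal_path l : exists p,
  [/\ path (@adj G) l p, uniq (l :: p) &
      forall u, adj (last l p) u -> u \in l :: p].
Proof.
(* A path is extended at its last vertex while possible; k bounds the number of extensions left. *)
suff ext k p : path (@adj G) l p -> uniq (l :: p) -> #|G| - size p <= k ->
    exists q, [/\ path (@adj G) l q, uniq (l :: q) &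
                  forall u, adj (last l q) u -> u \in l :: q].
  by apply: (ext #|G| [::]) => //; apply: leq_subr.
elim: k p => [|k IH] p pathp uniqp sizep.
  have: (size p).+1 <= #|G|.
    by rewrite -[_.+1]/(size (l :: p)) -(card_uniqP uniqp) max_card.
  by move: sizep; move: #|G|; lia.
case: (pickP [pred u | adj (last l p) u && (u \notin l :: p)]) => [u|maxp].
  move=> /andP[adju notinu]; apply: (IH (rcons p u)).
  - by rewrite rcons_path pathp.
  - by rewrite -rcons_cons rcons_uniq notinu.
  - by rewrite size_rcons; move: sizep; move: #|G|; lia.
exists p; split=> // u adju; apply: contraFT (maxp u) => notinu.
by rewrite /= adju.
Qed.

Lemma nbh_eq v (A : {set G}) : A \subset nbh v -> deg v <= #|A| -> nbh v = A.
Proof. by move=> subA cardA; apply/esym/eqP; rewrite eqEcard subA. Qed.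

Lemma line_tadpole_recognition l w :
  comps [set: G] = 1 -> deg l = 1 -> deg w = 3 ->
  (forall v, v != l -> v != w -> deg v = 2) ->
  exists a, [/\ 0 < a, a + 2 < #|G| & isomorphic G (line_tadpole #|G| a)].
Proof.
move=> connG deg_l deg_w deg_other.
have [p [pathp uniqp maxp]] := maximal_path l.
pose n := (size p).+1; pose h i := nth l (l :: p) i.
have hE i j : i < n -> j < n -> (h i == h j) = (i == j).
  by move=> i_n j_n; rewrite nth_uniq.
have h0 : h 0 = l by [].
have adjS i : i.+1 < n -> adj (h i) (h i.+1).
  by move=> i_n; apply: (pathP l pathp).
have memh u : u \in l :: p -> exists2 i, i < n & u = h i.
  by move=> /(nthP l)[i i_n <-]; exists i.
have lastE : last l p = h n.-1 by rewrite (last_nth l).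
have n_gt1 : 1 < n.
  have /card_gt0P[u] : 0 < #|nbh l| by rewrite -/(deg l) deg_l.
  rewrite inE /n; case: (p) maxp => //= maxp adju.
  by have:= maxp u adju; rewrite inE => /eqP uE; rewrite uE adj_irr in adju.
have deg_ge2 v : v != l -> 1 < deg v.
  by move=> vl; have [->|vw] := eqVneq v w; rewrite ?deg_w ?deg_other.
have neq_last : h n.-1 != l by rewrite -h0 hE; lia.
have adj_last : adj (h n.-1) (h n.-2).
  by rewrite adj_sym -[n.-1]prednK; [apply: adjS|]; lia.
(* The last vertex has degree at least 2, hence a neighbour other than its predecessor; by
   maximality it is on the path, at a position other than n - 1 and n - 2. *)
have [a a_n adja] : exists2 a, a + 2 < n & adj (h n.-1) (h a).
  have := deg_ge2 _ neq_last; rewrite ltnNge => /negP nle.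
  case: (pickP [pred u | adj (h n.-1) u && (u != h n.-2)]) => [u|none].
    move=> /= /andP[adju uneq]; have:= maxp u; rewrite lastE => /(_ adju)/memh.
    case=> j j_n uE; rewrite uE in adju uneq; exists j => //.
    have : h n.-1 != h j by apply: contraTneq adju => ->; rewrite adj_irr.
    by move: uneq; rewrite !hE; lia.
  case: nle; rewrite -(cards1 (h n.-2)); apply: subset_leq_card.
  apply/subsetP=> u; rewrite !inE => adju.
  by have:= none u; rewrite /= adju => /negbFE.
(* Otherwise the leaf would have the two neighbours [h 1] and [h n.-1]. *)
have a_gt0 : 0 < a.
  rewrite lt0n; apply/negP=> /eqP a0.
  have: #|[set h 1; h n.-1]| <= #|nbh l|.
    apply/subset_leq_card/subsetP=> u /set2P[]->; rewrite inE.
      by apply: (adjS 0); lia.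
    by rewrite adj_sym -h0 -a0.
  by rewrite -/(deg l) deg_l cards2 hE; lia.
have sub_a : [set h a.-1; h a.+1; h n.-1] \subset nbh (h a).
  apply/subsetP=> u; rewrite !inE => /orP[/orP[]|] /eqP->.
  - by rewrite adj_sym -{2}[a]prednK //; apply: adjS; lia.
  - by apply: adjS; lia.
  - by rewrite adj_sym.
have card_a : #|[set h a.-1; h a.+1; h n.-1]| = 3.
  by rewrite -setUA cardsU1 cards2 !inE !hE; lia.
(* [h a] has three distinct neighbours and is not the leaf, so only w is left. *)
have wE : w = h a.
  apply/eqP; apply: contraT => neq_wa; have:= subset_leq_card sub_a.
  rewrite card_a -/(deg _) deg_other // 1?eq_sym // -h0 hE; lia.
(* The neighbours already known for each path vertex exhaust its degree. As u is not assumed to be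
   on the path, this yields both closure of the path under adjacency and the model adjacency of
   [adj_line]. *)
have nbhP i u : i < n -> u \in nbh (h i) -> exists2 k, k < n & u = h k /\
    [|| i.+1 == k, k.+1 == i, (i == a) && (k.+1 == n) |
        (k == a) && (i.+1 == n)].
  move=> i_n; have [i0|i_gt0] := posnP i.
    rewrite (@nbh_eq _ [set h 1]) ?cards1; last by rewrite i0 h0 deg_l.
      by move/set1P->; exists 1 => //; split=> //; lia.
    by rewrite sub1set inE i0; apply: adjS.
  have adj_pred : adj (h i) (h i.-1).
    by rewrite adj_sym -{2}[i]prednK //; apply: adjS; lia.
  have [->|ia] := eqVneq i a.
    rewrite (nbh_eq sub_a); last by rewrite card_a -wE deg_w.
    rewrite !inE => /orP[/orP[]|] /eqP->; [exists a.-1|exists a.+1|exists n.-1];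
      by [lia | split=> //; lia].
  have deg_i : deg (h i) = 2.
    by rewrite deg_other // ?wE -?h0 ?hE; lia.
  have [i_last|i_nlast] := eqVneq i n.-1.
    rewrite (@nbh_eq _ [set h i.-1; h a]).
    - by move/set2P=> []->; [exists i.-1|exists a]; by [lia | split=> //; lia].
    - by apply/subsetP=> v /set2P[]->; rewrite inE // i_last.
    - by rewrite deg_i cards2 hE; lia.
  rewrite (@nbh_eq _ [set h i.-1; h i.+1]).
  - by move/set2P=> []->; [exists i.-1|exists i.+1]; by [lia | split=> //; lia].
  - by apply/subsetP=> v /set2P[]->; rewrite inE //; apply: adjS; lia.
  - by rewrite deg_i cards2 hE; lia.
(* The path is closed under adjacency in a connected graph, so it visits every vertex. *)
have closp : closed (restrict [set: G]) (mem (l :: p)).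
  apply: intro_closed; first exact: restrict_connect_sym.
  move=> u v /and3P[_ _ adjuv] /memh[i i_n uE].
  have [|k k_n [-> _]] := nbhP i v i_n; first by rewrite inE -uE.
  exact: mem_nth.
have allp v : v \in l :: p.
  have /eqP/comps1P[u _ connu] := connG.
  rewrite -(closed_connect closp (connu v _)) //.
  by rewrite (closed_connect closp (connu l _)) ?mem_head.
have cardG : #|G| = n.
  rewrite -[n]/(size (l :: p)) -(card_uniqP uniqp).
  by apply: eq_card => v; rewrite allp.
exists a; rewrite cardG; split=> //; apply: isomorphic_sym.
exists (fun i : line_tadpole n a => h i).
  apply: inj_card_bij; last by rewrite cardG card_ord.
  by move=> i j /eqP; rewrite hE ?ltn_ord // => /eqP/val_inj.
move=> i j; have i_n := ltn_ord i; have j_n := ltn_ord j.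
rewrite adj_line //; apply/idP/idP => [adjij|].
  have [|k k_n [/eqP hjk model_ik]] := nbhP i (h j) i_n; first by rewrite inE.
  by move: hjk; rewrite hE // => /eqP->.
case/or4P=> [/eqP E|/eqP E|/andP[/eqP iE /eqP jE]|/andP[/eqP jE /eqP iE]].
- by rewrite -E; apply: adjS; rewrite E.
- by rewrite adj_sym -E; apply: adjS; rewrite E.
- by rewrite adj_sym iE; have <- : n.-1 = j by have:= congr1 predn jE.
- by rewrite jE; have <- : n.-1 = i by have:= congr1 predn iE.
Qed.

End Recognition.

(** * Reconstruction of the tadpole from Q *)

Theorem theorem4p4 (m n : nat) (hm : 1 <= m) (hn : 3 <= n) :
  Q_unique (tadpole m n).
Proof.
move=> H QH; have isoT := @tadpole_line m n hn.
have mN : m + 2 < m + n by lia.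
have QHT : Qpoly H = Qpoly (line_tadpole (m + n) m).
  by rewrite QH; apply: Qpoly_isomorphic.
have cardH : #|H| = m + n by rewrite (eq_card_Qpoly QHT) card_ord.
(* The only set of m + n vertices is the whole vertex set, so the coefficient of x^(m+n) y detects
   connectedness. *)
have connH : comps [set: H] = 1.
  have: 0 < subset_count H (m + n) 1.
    rewrite (eq_subset_count_Qpoly QHT); apply/card_gt0P.
    by exists setT; rewrite inE cardsT card_ord eqxx comps_line_setT.
  case/card_gt0P=> X; rewrite inE -cardH => /andP[cardX /eqP compX].
  have <- : X = setT.
    by apply/eqP; rewrite eqEcard subsetT cardsT (eqP cardX) /=.
  by [].
(* For N = m + n the tadpole gives 1 + 3 + 2(N - 2) = 2N and 0 + 3 + (N - 2) = N + 1. *)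
have [||l [w [deg_l deg_w deg_other]]] := @degree_sequence H.
- by rewrite (eq_sum_deg QHT) (sum_line hm mN id) cardH; lia.
- rewrite (eq_sum_deg_bin2 QHT) (sum_line hm mN (fun d => 'C(d, 2))) cardH.
  by rewrite binn bin_small // (_ : 'C(3, 2) = 3) //; lia.
have [a [a_gt0 aN isoH]] :=
  line_tadpole_recognition connH deg_l deg_w deg_other.
rewrite cardH in aN isoH.
(* The coefficient of x^(N-1) y is N - a for one graph and N - m for the other. *)
have aE : a = m.
  have:= subset_count_line a_gt0 aN.
  rewrite -(eq_subset_count_Qpoly (Qpoly_isomorphic isoH)).
  by rewrite (eq_subset_count_Qpoly QHT) (subset_count_line hm mN); lia.
apply: isomorphic_trans (isomorphic_sym isoT).
by rewrite aE in isoH.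
Qed.
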